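(* Let $$v_i:=\frac{\sum_{j=1}^n\omega_j\mathbf{A}_{ji}^2}{\sum_{j=1}^n\mathbf{A}_{ji}^2},\qquad i=1,\dots,d.$$ Then $\sigma\le\tilde\sigma:=\max_{1\le i\le d}v_i$.
   Context: $\mathbf{A}$ is an $n\times d$ real matrix with no zero row and no zero column, and $\mathbf{M}:=\mathbf{A}^\top\mathbf{A}$. $\omega_j$ is the number of nonzeros in the $j$-th row of $\mathbf{A}$. $D^{\mathbf{M}}$ denotes the $d\times d$ diagonal matrix with $D^{\mathbf{M}}_{ii}=\mathbf{M}_{ii}$ for all $i$. Define $$\sigma:=\max\{x^\top\mathbf{M}x: x\in\mathbb{R}^d,\ x^\top D^{\mathbf{M}}x\le1\}.$$ *)

(* Defs.v *)
From mathcomp Require Import all_boot all_order all_algebra.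
From mathcomp Require Import all_classical all_reals all_analysis.
Import Order.TTheory GRing.Theory Num.Theory.
Import numFieldTopology.Exports numFieldNormedType.Exports.

Set Implicit Arguments.
Unset Strict Implicit.
Unset Printing Implicit Defensive.

Local Open Scope classical_set_scope.
Local Open Scope ring_scope.

Definition no_zero_row (R : realType) (n d : nat) (A : 'M[R]_(n, d)) : Prop :=
  forall j : 'I_n, row j A != 0.

Definition no_zero_col (R : realType) (n d : nat) (A : 'M[R]_(n, d)) : Prop :=
  forall i : 'I_d, col i A != 0.

Definition gram (R : realType) (n d : nat) (A : 'M[R]_(n, d)) : 'M[R]_d :=
  A^T *m A.

Definition omega (R : realType) (n d : nat) (A : 'M[R]_(n, d)) (j : 'I_n) : nat :=
  #|[set i : 'I_d | A j i != 0]%SET|.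

Definition diag_part (R : realType) (d : nat) (M : 'M[R]_d) : 'M[R]_d :=
  diag_mx (\row_(i < d) M i i).

Definition qform (R : realType) (d : nat) (M : 'M[R]_d) (x : 'cV[R]_d) : R :=
  (x^T *m M *m x) 0 0.

Definition sigma_set (R : realType) (n d : nat) (A : 'M[R]_(n, d)) : set R :=
  [set qform (gram A) x | x in
    [set x : 'cV[R]_d | qform (diag_part (gram A)) x <= 1]].

(* The supremum is a maximum when A has no zero column: see sigma_is_max. *)
Definition sigma (R : realType) (n d : nat) (A : 'M[R]_(n, d)) : R :=
  sup (sigma_set A).

Definition v (R : realType) (n d : nat) (A : 'M[R]_(n, d)) (i : 'I_d) : R :=
  (\sum_(j < n) (omega A j)%:R * A j i ^+ 2) / (\sum_(j < n) A j i ^+ 2).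

(* The v A i are nonnegative, so the base value 0 only matters when d = 0:
   see sigma_tilde_is_max. *)
Definition sigma_tilde (R : realType) (n d : nat) (A : 'M[R]_(n, d)) : R :=
  \big[Num.max/0]_(i < d) v A i.

Lemma qformE (R : realType) (d : nat) (M : 'M[R]_d) (x : 'cV[R]_d) :
  qform M x = \sum_(k < d) \sum_(i < d) x i 0 * M i k * x k 0.
Proof.
rewrite /qform mxE; apply: eq_bigr => k _.
rewrite mxE mulr_suml; apply: eq_bigr => i _.
by rewrite mxE.
Qed.

Lemma qform_diag_part (R : realType) (d : nat) (M : 'M[R]_d) (x : 'cV[R]_d) :
  qform (diag_part M) x = \sum_(k < d) M k k * x k 0 ^+ 2.
Proof.
rewrite qformE; apply: eq_bigr => k _.
rewrite (bigD1 k)//= big1 => [|i ik].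
  by rewrite !mxE eqxx mulr1n addr0 mulrC mulrA mulrC -expr2.
by rewrite !mxE (negbTE ik) mulr0n mulr0 mul0r.
Qed.

Lemma gram_diag (R : realType) (n d : nat) (A : 'M[R]_(n, d)) (i : 'I_d) :
  gram A i i = \sum_(j < n) A j i ^+ 2.
Proof. by rewrite mxE; apply: eq_bigr => j _; rewrite mxE expr2. Qed.

Lemma gram_diag_gt0 (R : realType) (n d : nat) (A : 'M[R]_(n, d)) (i : 'I_d) :
  no_zero_col A -> 0 < gram A i i.
Proof.
move=> /(_ i) Ai; rewrite gram_diag lt_neqAle eq_sym sumr_ge0 ?andbT; last first.
  by move=> j _; exact: sqr_ge0.
apply: contra Ai; rewrite psumr_eq0 => [/allP s0|j _]; last exact: sqr_ge0.
apply/eqP/matrixP => j k; rewrite !mxE; apply/eqP.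
by rewrite -sqrf_eq0; apply: s0; rewrite mem_index_enum.
Qed.

Lemma continuous_qform_tr (R : realType) (d : nat) (M : 'M[R]_d) :
  continuous (fun y : 'rV[R]_d => qform M y^T).
Proof.
have -> : (fun y : 'rV[R]_d => qform M y^T) =
    (fun y => \sum_(k < d) \sum_(i < d) y 0 i * M i k * y 0 k).
  apply/funext => y; rewrite qformE.
  by apply: eq_bigr => k _; apply: eq_bigr => i _; rewrite !mxE.
apply: continuous_big => [|k _]; first exact: add_continuous.
apply: continuous_big => [|i _]; first exact: add_continuous.
move=> y; apply: (@continuousM _ _ (fun y : 'rV[R]_d => y 0 i * M i k)
  (fun y : 'rV[R]_d => y 0 k)); last exact: coord_continuous.
apply: (@continuousM _ _ (fun y : 'rV[R]_d => y 0 i) (fun=> M i k)).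
  exact: coord_continuous.
exact: cst_continuous.
Qed.

Lemma sigma_is_max (R : realType) (n d : nat) (A : 'M[R]_(n, d)) :
  no_zero_col A -> sigma_set A (sigma A) /\ ubound (sigma_set A) (sigma A).
Proof.
move=> A0; set M := gram A.
pose B : set 'rV[R]_d := [set y | qform (diag_part M) y^T <= 1].
have B0 : B !=set0.
  by exists 0; rewrite /B/= qform_diag_part big1// => k _; rewrite !mxE expr0n mulr0.
have clB : closed B.
  have -> : B = (fun y : 'rV[R]_d => qform (diag_part M) y^T) @^-1` [set r | r <= 1].
    by [].
  apply: preimage_closed; last exact: closed_le.
  by move=> y _; exact: continuous_qform_tr.
have bdB : bounded_set B.
  pose K := \sum_(k < d) (1 + (M k k)^-1).
  have K0 k : 0 <= 1 + (M k k)^-1.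
    by rewrite addr_ge0// invr_ge0 ltW// gram_diag_gt0.
  have K_ge k : 1 + (M k k)^-1 <= K.
    by rewrite /K (bigD1 k)//= lerDl sumr_ge0.
  exists K; split; first exact: num_real.
  move=> N KN y By /=; rewrite [leLHS]/Num.Def.normr/= mx_normrE; apply: bigmax_le.
    by rewrite ltW// (le_lt_trans _ KN)// sumr_ge0.
  move=> [i k] _ /=; rewrite (ord1 i); apply: le_trans (ltW KN).
  apply: le_trans (K_ge k).
  have Mk : 0 < M k k by exact: gram_diag_gt0.
  have : M k k * y 0 k ^+ 2 <= 1.
    apply: le_trans By; rewrite /= qform_diag_part (bigD1 k)//= [y^T _ _]mxE lerDl.
    apply: sumr_ge0 => l _; rewrite mulr_ge0 ?sqr_ge0//.
    by rewrite ltW// gram_diag_gt0.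
  rewrite -ler_pdivlMl// mulr1 -real_normK ?num_real// => yk.
  have [y1|y1] := leP `|y 0 k| 1; first by rewrite (le_trans y1)// lerDl invr_ge0 ltW.
  rewrite (@le_trans _ _ (`|y 0 k| ^+ 2))//; last by rewrite (le_trans yk)// lerDr.
  by rewrite expr2 ler_peMl// ltW.
have [c Bc cmax] := @EVT_max_rV R d (fun y => qform M y^T) B B0
  (bounded_closed_compact bdB clB) (continuous_subspaceT (@continuous_qform_tr R d M)).
have Sc : sigma_set A (qform M c^T).
  by exists c^T => //; move: Bc; rewrite inE.
have ubc : ubound (sigma_set A) (qform M c^T).
  move=> _ [x xB <-]; rewrite -[x]trmxK; apply: cmax.
  by rewrite inE /B/= trmxK.
suff -> : sigma A = qform M c^T by [].
apply/eqP; rewrite eq_le; apply/andP; split.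
  by apply: ge_sup => //; exists (qform M c^T).
by apply: ub_le_sup => //; exists (qform M c^T).
Qed.

Lemma sigma_tilde_is_max (R : realType) (n d : nat) (A : 'M[R]_(n, d)) :
  (0 < d)%N ->
  (exists i, sigma_tilde A = v A i) /\ (forall i, v A i <= sigma_tilde A).
Proof.
move=> d0; split; last by move=> i; exact: le_bigmax.
have v0 i : 0 <= v A i.
  rewrite divr_ge0// sumr_ge0// => j _; last exact: sqr_ge0.
  by rewrite mulr_ge0 ?sqr_ge0.
have [i _ vi] := @Order.TotalTheory.eq_bigmax _ R 'I_d 0 (Ordinal d0) predT (v A) isT (fun i _ => v0 i).
by exists i.
Qed.

(* Main.v *)
Require Import Defs.
From mathcomp Require Import all_boot all_order all_algebra.
From mathcomp Require Import all_classical all_reals all_analysis.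
From mathcomp Require Import lra.
Import Order.TTheory GRing.Theory Num.Theory.

Local Open Scope ring_scope.

(** The quadratic form of the Gram matrix is a sum of squares over the rows:
    [x^T M x = \sum_j (\sum_i A_ji x_i)^2]. Only [omega_j] terms of the inner
    sum are nonzero, so the Cauchy-Schwarz inequality bounds its square by
    [omega_j * \sum_i A_ji^2 x_i^2] ([sqr_row_sum_le]). Exchanging the two sums,
    the weight of [x_i^2] becomes [\sum_j omega_j A_ji^2 = v_i M_ii]
    ([mul_v_gram_diag]). Hence [x^T M x <= \sum_i v_i M_ii x_i^2], which is at
    most [max_i v_i] times the form [x^T D^M x], and the latter is at most [1]
    on the constraint set. *)

(** Summing [a_i a_k <= (a_i^2 + a_k^2) / 2] over all pairs in [S] gives the
    case of Cauchy-Schwarz in which one of the two vectors is the indicator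
    of [S]. *)
Lemma sqr_sum_le_card (R : realFieldType) (I : finType) (S : {set I})
    (a : I -> R) :
  (\sum_(i in S) a i) ^+ 2 <= #|S|%:R * \sum_(i in S) a i ^+ 2.
Proof.
have -> : #|S|%:R * \sum_(i in S) a i ^+ 2 =
    \sum_(i in S) \sum_(k in S) (a i ^+ 2 / 2 + a k ^+ 2 / 2).
  under [RHS]eq_bigr do rewrite big_split.
  rewrite big_split /= [X in _ + X]exchange_big /= -big_split /= mulr_sumr.
  apply: eq_bigr => i _; rewrite sumr_const -mulr_natl; lra.
rewrite expr2 mulr_suml; apply: ler_sum => i _.
rewrite mulr_sumr; apply: ler_sum => k _.
have := sqr_ge0 (a i - a k); nra.
Qed.

Lemma qform_gram (R : realType) (n d : nat) (A : 'M[R]_(n, d)) (x : 'cV[R]_d) :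
  qform (gram A) x = \sum_(j < n) (\sum_(i < d) A j i * x i 0) ^+ 2.
Proof.
rewrite /qform /gram mulmxA -trmx_mul -mulmxA mxE.
by apply: eq_bigr => j _; rewrite !mxE expr2.
Qed.

(** Zero entries of the row contribute to neither side, so Cauchy-Schwarz is
    applied on the support only; its constant is then the size [omega A j] of
    the support instead of [d]. *)
Lemma sqr_row_sum_le (R : realType) (n d : nat) (A : 'M[R]_(n, d))
    (x : 'cV[R]_d) (j : 'I_n) :
  (\sum_(i < d) A j i * x i 0) ^+ 2 <=
    (omega A j)%:R * \sum_(i < d) A j i ^+ 2 * x i 0 ^+ 2.
Proof.
pose S := [set i : 'I_d | A j i != 0]%SET.
have sumS (F : 'I_d -> R) : (forall i, A j i = 0 -> F i = 0) ->
    \sum_(i < d) F i = \sum_(i in S) F i.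
  move=> F0; rewrite [RHS]big_mkcond; apply: eq_bigr => i _.
  by rewrite inE; case: eqP => [/F0|].
rewrite !sumS => [|i ->|i ->]; [|by rewrite expr0n mul0r|by rewrite mul0r].
under [X in _ * X]eq_bigr do rewrite -exprMn.
exact: sqr_sum_le_card.
Qed.

Lemma mul_v_gram_diag (R : realType) (n d : nat) (A : 'M[R]_(n, d)) (i : 'I_d) :
  no_zero_col A ->
  v A i * gram A i i = \sum_(j < n) (omega A j)%:R * A j i ^+ 2.
Proof. by move=> A0; rewrite /v -gram_diag divfK// gt_eqF// gram_diag_gt0. Qed.

Lemma qform_gram_le (R : realType) (n d : nat) (A : 'M[R]_(n, d))
    (x : 'cV[R]_d) :
  no_zero_col A ->
  qform (gram A) x <= \sum_(i < d) v A i * (gram A i i * x i 0 ^+ 2).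
Proof.
move=> A0; rewrite qform_gram.
apply: le_trans (ler_sum _ (fun j _ => sqr_row_sum_le R n d A x j)) _.
under eq_bigr do rewrite mulr_sumr.
rewrite exchange_big /=; apply: ler_sum => i _.
rewrite mulrA mul_v_gram_diag// mulr_suml.
by apply: ler_sum => j _; rewrite mulrA.
Qed.

Theorem lemma6 (R : realType) (n d : nat) (A : 'M[R]_(n, d))
    (hrow : no_zero_row A) (hcol : no_zero_col A) :
  sigma A <= sigma_tilde A.
Proof.
have [[x /= xD <-] _] := sigma_is_max hcol.
apply: le_trans (qform_gram_le _ _ _ _ x hcol) _.
have st0 : 0 <= sigma_tilde A by exact: bigmax_ge_id.
apply: (@le_trans _ _ (sigma_tilde A * qform (diag_part (gram A)) x)).
  rewrite qform_diag_part mulr_sumr; apply: ler_sum => i _.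
  apply: ler_wpM2r; first by rewrite mulr_ge0 ?sqr_ge0// ltW// gram_diag_gt0.
  exact: le_bigmax.
by rewrite ler_piMr.
Qed.
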